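(* Let $\mathcal{L}(R_{k_1},\ldots,R_{k_p})$, $(k_1,\ldots,k_p)\in\mathbb{Z}^p$, be a family of oriented link diagrams which coincide outside $p$ disjoint discs and which in the $j$-th disc contain the 2-strand braid $x_1^{k_j}$ with both strands oriented in parallel (top to bottom). Let $P_{\mathcal{L}}(k_1,\ldots,k_p)\in\mathbb{C}[l^{\pm1},m^{\pm1}]$ be the HOMFLY polynomial of $\mathcal{L}(R_{k_1},\ldots,R_{k_p})$. Then for any $k_1,\ldots,k_p\in\mathbb{Z}$ and any $j\in\{1,2,\ldots,p\}$, $$P_{\mathcal{L}}(k_1,\ldots,k_j+2,\ldots,k_p)=-ml\,P_{\mathcal{L}}(k_1,\ldots,k_j+1,\ldots,k_p)-l^2\,P_{\mathcal{L}}(k_1,\ldots,k_j,\ldots,k_p).$$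
   Context: The HOMFLY polynomial is the oriented link invariant $P$ with values in $\mathbb{C}[l^{\pm1},m^{\pm1}]$ determined by $P(\bigcirc)=1$ (unknot) and the skein relation $lP(L_+)+l^{-1}P(L_-)+mP(L_0)=0$ whenever $L_+,L_-,L_0$ are oriented diagrams identical except near one crossing, where $L_+$ has a positive crossing (both strands pointing up, the over-strand goes from lower left to upper right), $L_-$ a negative crossing and $L_0$ the oriented smoothing. The 2-strand braid $x_1$ (generator of $\mathcal{B}_2$) is the crossing in which the strand going from top left to bottom right passes over the strand going from top right to bottom left; with both strands oriented from top to bottom it is a negative crossing (type $L_-$), and $x_1^{-1}$ is a positive crossing. *)

(* Defs.v *)
From HB Require Import structures.
From mathcomp Require Import all_boot all_order all_algebra.
From mathcomp Require Import boolp reals complex.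
From Stdlib Require Export Relation_Operators.

Set Implicit Arguments.
Unset Strict Implicit.
Unset Printing Implicit Defensive.

Import GRing.Theory.
Local Open Scope ring_scope.

Fact loc_subring (A : comNzRingType) (K : fieldType) (f : {rmorphism A -> K})
    (x y : A) :
  f x != 0 -> f y != 0 ->
  subring_closed (fun z : K => `[< exists (q : A) (a b : nat),
                                   z = f q / (f x ^+ a * f y ^+ b) >]).
Proof.
move=> x0 y0.
have mon a b : f x ^+ a * f y ^+ b = f (x ^+ a * y ^+ b).
  by rewrite rmorphM !rmorphXn.
have nz a b : f (x ^+ a * y ^+ b) != 0.
  by rewrite -mon mulf_neq0 ?expf_neq0.
split=> [|z t /asboolP[q [a [b ->]]] /asboolP[r [c [d ->]]]
        |z t /asboolP[q [a [b ->]]] /asboolP[r [c [d ->]]]];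
  apply/asboolP.
- by exists 1, 0%N, 0%N; rewrite rmorph1 !expr0 mulr1 divr1.
- exists (q * (x ^+ c * y ^+ d) - r * (x ^+ a * y ^+ b)), (a + c)%N, (b + d)%N.
  by rewrite !exprD mulrACA !mon -mulNr addf_div // rmorphB !rmorphM /= mulNr.
- by exists (q * r), (a + c)%N, (b + d)%N; rewrite mulf_div !exprD mulrACA rmorphM.
Qed.

(* F[l^+-1, m^+-1], as the subring of the rational functions in l, m formed by
   the fractions p / (l^a m^b) with p a polynomial. *)
Section Laurent.
Variable F : fieldType.

Definition ratl : {fraction {poly {poly F}}} := tofrac ('X%:P).
Definition ratm : {fraction {poly {poly F}}} := tofrac 'X.

Definition is_laurent : {pred {fraction {poly {poly F}}}} :=
  fun x => `[< exists (q : {poly {poly F}}) (a b : nat),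
                 x = tofrac q / (ratl ^+ a * ratm ^+ b) >].

Lemma ratl_neq0 : ratl != 0.
Proof. by rewrite tofrac_eq0 polyC_eq0 polyX_eq0. Qed.

Lemma ratm_neq0 : ratm != 0.
Proof. by rewrite tofrac_eq0 polyX_eq0. Qed.

Lemma is_laurentP x :
  reflect (exists (q : {poly {poly F}}) (a b : nat),
             x = tofrac q / (ratl ^+ a * ratm ^+ b)) (x \in is_laurent).
Proof. exact: asboolP. Qed.

Lemma is_laurent_subring : subring_closed is_laurent.
Proof. exact: loc_subring ratl_neq0 ratm_neq0. Qed.

HB.instance Definition _ :=
  GRing.isSubringClosed.Build _ is_laurent is_laurent_subring.

Record laurent := Laurent { laurent_val; _ : laurent_val \in is_laurent }.

HB.instance Definition _ := [isSub for laurent_val].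
HB.instance Definition _ := [Choice of laurent by <:].
HB.instance Definition _ := [SubChoice_isSubComNzRing of laurent by <:].

Definition laurent_unit : pred laurent :=
  fun x => (val x != 0) && ((val x)^-1 \in is_laurent).

Definition laurent_inv (x : laurent) : laurent :=
  if laurent_unit x then insubd 0 (val x)^-1 else x.

Fact laurent_mulVx : {in laurent_unit, left_inverse 1 laurent_inv *%R}.
Proof.
move=> x xu; rewrite /laurent_inv; have -> : laurent_unit x by [].
have /andP[x0 xV] := xu.
by apply: val_inj; rewrite rmorphM rmorph1 /= insubdK // mulVf.
Qed.

Fact laurent_intro_unit (x y : laurent) : y * x = 1 -> laurent_unit x.
Proof.
move=> /(congr1 val); rewrite rmorphM rmorph1 /= => yx1.
have x0 : val x != 0.
  by apply: contra_eq_neq yx1 => ->; rewrite mulr0 eq_sym oner_neq0.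
rewrite /laurent_unit x0 /=.
by rewrite -[_^-1]mul1r -yx1 mulfK //; exact: valP.
Qed.

Fact laurent_inv_out : {in [predC laurent_unit], laurent_inv =1 id}.
Proof.
move=> x xu; rewrite /laurent_inv.
by have /negbTE -> : ~~ laurent_unit x by [].
Qed.

HB.instance Definition _ := GRing.ComNzRing_hasMulInverse.Build laurent
  laurent_mulVx laurent_intro_unit laurent_inv_out.

Fact ratl_laurent : ratl \in is_laurent.
Proof.
by apply/is_laurentP; exists 'X%:P, 0%N, 0%N; rewrite !expr0 mulr1 divr1.
Qed.

Fact ratm_laurent : ratm \in is_laurent.
Proof.
by apply/is_laurentP; exists 'X, 0%N, 0%N; rewrite !expr0 mulr1 divr1.
Qed.

Definition lvar : laurent := Laurent ratl_laurent.
Definition mvar : laurent := Laurent ratm_laurent.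

Lemma lvar_unit : lvar \is a GRing.unit.
Proof.
rewrite /in_mem /= /GRing.unit_subdef /=; apply/andP; split.
  exact: ratl_neq0.
apply/is_laurentP; exists 1, 1%N, 0%N.
by rewrite rmorph1 expr1 expr0 mulr1 mul1r.
Qed.

Lemma mvar_unit : mvar \is a GRing.unit.
Proof.
rewrite /in_mem /= /GRing.unit_subdef /=; apply/andP; split.
  exact: ratm_neq0.
apply/is_laurentP; exists 1, 0%N, 1%N.
by rewrite rmorph1 expr1 expr0 !mul1r.
Qed.

End Laurent.

Local Open Scope nat_scope.

(* A diagram in general position with respect to the height function is read
   from top to bottom as a list of slices (i, e), each containing one elementary
   piece e with i vertical strands to its left.  A horizontal level is recorded
   by the orientations of its strands from left to right, [true] meaning
   downwards.
   - [Max b] is a local maximum whose left leg is oriented by b;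
   - [Min] is a local minimum;
   - [Cross s] is a crossing; s = [true] when the strand from top left to bottom
     right is the over-strand. *)
Inductive piece := Max of bool | Min | Cross of bool.

Definition slice := (nat * piece)%type.

Definition npiece_top (e : piece) := if e is Max _ then 0 else 2.
Definition npiece_bot (e : piece) := if e is Min then 0 else 2.

Definition step (st : seq bool) (x : slice) : option (seq bool) :=
  let: (i, e) := x in
  match e, drop i st with
  | Max b, r =>
      if i <= size st then Some (take i st ++ [:: b, ~~ b & r]) else None
  | Min, [:: a, b & r] => if a != b then Some (take i st ++ r) else None
  | Cross _, [:: a, b & r] => Some (take i st ++ [:: b, a & r])
  | _, _ => None
  end.

Fixpoint run (st : seq bool) (w : seq slice) : option (seq bool) :=
  if w is x :: w' then obind (run ^~ w') (step st x) else Some st.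

Record link_diagram := LinkDiagram {
  slices :> seq slice;
  slices_closed : run [::] slices == Some [::]
}.

(* Generators of isotopy for diagrams in general position (Turaev,
   Freyd-Yetter): the planar moves (exchange of distant pieces, cancellation of a maximum against a minimum, a
   strand sliding over or under an extremum) and the Reidemeister moves.  They
   make no mention of the ambient orientations: [diagram_move] requires both
   sides to be diagrams, which forces these to agree.  In R3, the condition on
   s1, s2, s3 says that one of the three strands lies above the two others and
   one below. *)
Inductive local_move : seq slice -> seq slice -> Prop :=
| move_exchange i j e f : i <= j ->
    local_move [:: (i, e); (j + npiece_bot e, f)]
               [:: (j + npiece_top e, f); (i, e)]
| move_zigzag_l i b : local_move [:: (i, Max b); (i.+1, Min)] [::]
| move_zigzag_r i b : local_move [:: (i.+1, Max b); (i, Min)] [::]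
| move_slide_max i b s :
    local_move [:: (i.+1, Max b); (i, Cross s)]
               [:: (i, Max b); (i.+1, Cross (~~ s))]
| move_slide_min i s :
    local_move [:: (i, Cross s); (i.+1, Min)]
               [:: (i.+1, Cross (~~ s)); (i, Min)]
| move_R1_max i b s :
    local_move [:: (i, Max b); (i, Cross s)] [:: (i, Max (~~ b))]
| move_R1_min i s : local_move [:: (i, Cross s); (i, Min)] [:: (i, Min)]
| move_R2 i s : local_move [:: (i, Cross s); (i, Cross (~~ s))] [::]
| move_R3 i s1 s2 s3 : (s2 == s1) || (s2 == s3) ->
    local_move [:: (i, Cross s1); (i.+1, Cross s2); (i, Cross s3)]
               [:: (i.+1, Cross s3); (i, Cross s2); (i.+1, Cross s1)].

Definition diagram_move (D E : link_diagram) : Prop :=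
  exists (u v x y : seq slice), local_move x y /\
    slices D = u ++ x ++ v /\ slices E = u ++ y ++ v.

Definition isotopic : link_diagram -> link_diagram -> Prop :=
  clos_refl_sym_trans link_diagram diagram_move.

Definition unknot : link_diagram :=
  @LinkDiagram [:: (0, Max true); (0, Min)] isT.

(* The type of a crossing of sign [pos] (true = positive) whose upper ends are
   oriented by a and b.  When a = b, the strand joining lower left to upper
   right is the over-strand iff the crossing is positive; reversing one of the
   two strands changes the sign. *)
Definition cross_of_sign (pos a b : bool) : piece := Cross (pos (+) (a == b)).

(* The oriented smoothing: two vertical strands if the strands are parallel, a
   minimum above a maximum otherwise. *)
Definition smoothing (i : nat) (a b : bool) : seq slice :=
  if a == b then [::] else [:: (i, Min); (i, Max b)].

Definition skein_triple (Dp Dm D0 : link_diagram) : Prop :=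
  exists (u v : seq slice) (i : nat) (st r : seq bool) (a b : bool),
    run [::] u = Some st /\ drop i st = [:: a, b & r] /\
    slices Dp = u ++ (i, cross_of_sign true a b) :: v /\
    slices Dm = u ++ (i, cross_of_sign false a b) :: v /\
    slices D0 = u ++ smoothing i a b ++ v.

Local Open Scope ring_scope.

(* The properties characterizing the HOMFLY polynomial among the functions on
   diagrams of nonempty links; the value on the empty diagram is unconstrained. *)
Record is_homfly (F : fieldType) (P : link_diagram -> laurent F) : Prop := {
  homfly_isotopy : forall D E, isotopic D E -> P D = P E;
  homfly_unknot : P unknot = 1;
  homfly_skein : forall Dp Dm D0, skein_triple Dp Dm D0 ->
    lvar F * P Dp + (lvar F)^-1 * P Dm + mvar F * P D0 = 0
}.

Local Open Scope nat_scope.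

(* The common exterior of a family of diagrams: a diagram which, besides
   elementary pieces, has p discs, the slice [inr (i, j)] being the j-th disc
   with i strands to its left; a disc is entered by two downward strands and
   left by two downward strands. *)
Definition slot (p : nat) := (slice + (nat * 'I_p))%type.

Definition slot_step p (st : seq bool) (x : slot p) : option (seq bool) :=
  match x with
  | inl y => step st y
  | inr (i, _) => if take 2 (drop i st) == [:: true; true] then Some st else None
  end.

Fixpoint slot_run (p : nat) (st : seq bool) (w : seq (slot p)) : option (seq bool) :=
  if w is x :: w' then obind (fun st' => @slot_run p st' w') (slot_step st x) else Some st.

Definition slot_disc p (x : slot p) : option 'I_p :=
  if x is inr (_, j) then Some j else None.

Record exterior (p : nat) := Exterior {
  slots :> seq (slot p);
  slots_closed : slot_run [::] slots == Some [::];
  slots_discs : perm_eq (pmap (@slot_disc p) slots) (enum 'I_p)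
}.

(* x_1^k, with i strands to its left; read on downward strands, [Cross true] is
   x_1, a negative crossing, and [Cross false] its inverse. *)
Definition braid_power (i : nat) (k : int) : seq slice :=
  match k with
  | Posz n => nseq n (i, Cross true)
  | Negz n => nseq n.+1 (i, Cross false)
  end.

Definition fill_slot p (k : 'I_p -> int) (x : slot p) : seq slice :=
  match x with
  | inl y => [:: y]
  | inr (i, j) => braid_power i (k j)
  end.

Definition fill_slices p (k : 'I_p -> int) (w : seq (slot p)) : seq slice :=
  flatten (map (fill_slot k) w).

Lemma run_cons st x w : run st (x :: w) = obind (run ^~ w) (step st x).
Proof. by []. Qed.

Lemma run_cat st w1 w2 : run st (w1 ++ w2) = obind (run ^~ w2) (run st w1).
Proof. by elim: w1 st => //= x w1 IH st; case: (step st x). Qed.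

Lemma run_braid_power st i k :
  take 2 (drop i st) = [:: true; true] -> run st (braid_power i k) = Some st.
Proof.
move=> h; have hs s : step st (i, Cross s) = Some st.
  rewrite /= -[in RHS](cat_take_drop i st).
  by case: (drop i st) h => [|a [|b r]] //= [-> ->]; rewrite take0.
have hn s n : run st (nseq n (i, Cross s)) = Some st.
  by elim: n => // n IH; rewrite [nseq _ _]/= run_cons hs.
by case: k => n; apply: hn.
Qed.

Lemma run_fill_slices p (k : 'I_p -> int) st w st' :
  slot_run st w = Some st' -> run st (fill_slices k w) = Some st'.
Proof.
rewrite /fill_slices; elim: w st => [|x w IH] //= st.
case: x => [y|[i j]] /=; first by case: (step st y) => //= st1 /IH.
by case: eqP => //= h /IH; rewrite run_cat run_braid_power.
Qed.

Fact fill_closed p (k : 'I_p -> int) (T : exterior p) :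
  run [::] (fill_slices k T) == Some [::].
Proof. by apply/eqP/run_fill_slices/eqP/slots_closed. Qed.

Definition fill p (T : exterior p) (k : 'I_p -> int) : link_diagram :=
  LinkDiagram (fill_closed k T).

(* Main.v *)
Require Import Defs.
From mathcomp Require Import all_boot all_order all_algebra.
From mathcomp Require Import reals complex.
From mathcomp Require Import ring zify.
Import GRing.Theory.
Local Open Scope ring_scope.

(** Applying the skein relation to an extra crossing put on top of [x_1^(k+1)]
    in the j-th disc gives a triple whose smoothing is [x_1^(k+1)] and whose two
    crossed members are, up to a Reidemeister move R2, [x_1^(k+2)] (negative
    crossing added) and [x_1^k] (positive crossing added). *)

Lemma link_diagram_inj (D E : link_diagram) : slices D = slices E -> D = E.
Proof.
case: D E => [w cw] [w' cw'] /= eq_w.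
by case: _ / eq_w cw' => cw'; rewrite (bool_irrelevance cw cw').
Qed.

Lemma isotopic_eq_slices (D E : link_diagram) :
  slices D = slices E -> isotopic D E.
Proof. by move=> /link_diagram_inj ->; apply: rst_refl. Qed.

Lemma isotopic_R2 (D E : link_diagram) u v i s :
  slices D = u ++ (i, Cross s) :: (i, Cross (~~ s)) :: v ->
  slices E = u ++ v -> isotopic D E.
Proof.
move=> eD eE; apply: rst_step.
exists u, v, [:: (i, Cross s); (i, Cross (~~ s))], [::].
by split; first exact: move_R2.
Qed.

(** [braid_power] is a reduced word: its letters all have the same type. The new crossing therefore
    either lengthens the word, and the two slice lists are equal, or it is opposite to the first
    letter, and one R2 move cancels the pair. *)
Lemma isotopic_braid_cross (D E : link_diagram) u v i s (k : int) :
  slices D = u ++ (i, Cross s) :: braid_power i k ++ v ->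
  slices E = u ++ braid_power i (if s then k + 1 else k - 1) ++ v ->
  isotopic D E.
Proof.
(* As [Negz n] stands for -(n+1), the values -1 and 0 are split off: there the word changes sign or
   becomes empty. *)
case: s k => [] [[|n]|[|n]] eD.
- by move=> eE; apply: isotopic_eq_slices; rewrite eD eE.
- rewrite (_ : _ + 1 = Posz n.+2); last lia.
  by move=> eE; apply: isotopic_eq_slices; rewrite eD eE.
- by move=> eE; apply: isotopic_R2 eD eE.
- rewrite (_ : _ + 1 = Negz n); last lia.
  by move=> eE; apply: isotopic_R2 eD eE.
- by move=> eE; apply: isotopic_eq_slices; rewrite eD eE.
- rewrite (_ : _ - 1 = Posz n); last lia.
  by move=> eE; apply: isotopic_R2 eD eE.
- by move=> eE; apply: isotopic_eq_slices; rewrite eD eE.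
- rewrite (_ : _ - 1 = Negz n.+2); last lia.
  by move=> eE; apply: isotopic_eq_slices; rewrite eD eE.
Qed.

Lemma run_parallel_cross st i s :
  take 2 (drop i st) = [:: true; true] -> step st (i, Cross s) = Some st.
Proof.
move=> st_i.
(* A single crossing on two downward strands is the braid power of exponent 1 or -1. *)
have := @run_braid_power st i (if s then Posz 1 else Negz 0) st_i.
by case: s; rewrite run_cons; case: (step _ _).
Qed.

(** Absence of [j] on both sides is what makes the rest of the diagram independent of the j-th
    exponent. *)
Lemma split_disc p (w : seq (slot p)) (j : 'I_p) :
  uniq (pmap (@slot_disc p) w) -> j \in pmap (@slot_disc p) w ->
  exists w1 i w2, [/\ w = w1 ++ inr (i, j) :: w2,
    j \notin pmap (@slot_disc p) w1 & j \notin pmap (@slot_disc p) w2].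
Proof.
elim: w => [|[y|[i j']] w IHw] //=.
  by move=> /IHw{}IHw /IHw[w1 [i [w2 [-> ? ?]]]]; exists (inl y :: w1), i, w2.
case/andP=> j'w /IHw{}IHw; rewrite inE; case: (eqVneq j j') => [->|jj'] /=.
  by exists [::], i, w.
move=> /IHw[w1 [i1 [w2 [-> jw1 jw2]]]]; exists (inr (i, j') :: w1), i1, w2.
by split=> //=; rewrite inE negb_or jj'.
Qed.

Lemma eq_fill_slices p (k k' : 'I_p -> int) (w : seq (slot p)) :
  {in pmap (@slot_disc p) w, k =1 k'} -> fill_slices k w = fill_slices k' w.
Proof.
rewrite /fill_slices; elim: w => [|[y|[i j]] w IHw] //= kk'; first by rewrite IHw.
rewrite (kk' j) ?mem_head // IHw // => j' j'w.
by rewrite kk' // inE j'w orbT.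
Qed.

Lemma slot_run_cat p st (w1 w2 : seq (slot p)) :
  slot_run st (w1 ++ w2) = obind (fun st' => slot_run st' w2) (slot_run st w1).
Proof. by elim: w1 st => //= x w1 IH st; case: (slot_step st x). Qed.

(** The surroundings [u], [v] are chosen before [k'], so all diagrams of the skein triple share
    them. The level [st] at the disc is kept so that a further crossing can be inserted there. *)
Lemma fill_disc p (L : exterior p) (k : 'I_p -> int) (j : 'I_p) :
  exists u v i st, [/\ run [::] u = Some st, run st v = Some [::],
    take 2 (drop i st) = [:: true; true] &
    forall k' : 'I_p -> int, (forall j', j' != j -> k' j' = k j') ->
      slices (fill L k') = u ++ braid_power i (k' j) ++ v].
Proof.
have discsL := slots_discs L.
have uniqL : uniq (pmap (@slot_disc p) L) by rewrite (perm_uniq discsL) enum_uniq.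
have jL : j \in pmap (@slot_disc p) L by rewrite (perm_mem discsL) mem_enum.
have [w1 [i [w2 [defL jw1 jw2]]]] := split_disc _ _ _ uniqL jL.
have := eqP (slots_closed L); rewrite defL slot_run_cat.
case run1: (slot_run [::] w1) => [st|] //=; case: eqP => //= st_i run2.
exists (fill_slices k w1), (fill_slices k w2), i, st.
split=> [||//|k' kk'] /=; try exact: run_fill_slices.
have eq_w w0 : j \notin pmap (@slot_disc p) w0 ->
    fill_slices k' w0 = fill_slices k w0.
  move=> jw0; apply: eq_fill_slices => j' j'w0; apply: kk'.
  by apply: contraNneq jw0 => <-.
by rewrite defL -(eq_w _ jw1) -(eq_w _ jw2) /fill_slices map_cat flatten_cat.
Qed.

(** Here [x], [y], [z] play the values at the negative crossing, the positive crossing and the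
    smoothing; multiplying the skein relation by [l] isolates [x]. *)
Lemma skein_solve (A : comUnitRingType) (l m x y z : A) :
  l \is a GRing.unit -> l * y + l^-1 * x + m * z = 0 ->
  x = - (m * l) * z - l ^+ 2 * y.
Proof.
move=> l_unit skein; rewrite -[LHS](mulVKr l_unit).
have -> : l^-1 * x = - (l * y) - m * z.
  by apply/eqP; rewrite -subr_eq0 -[X in _ == X]skein; apply/eqP; ring.
by ring.
Qed.

Theorem proposition1p4 (R : realType)
    (P : link_diagram -> laurent R[i]) (hP : is_homfly P)
    (p : nat) (L : exterior p) (k : 'I_p -> int) (j : 'I_p) :
  P (fill L [eta k with j |-> k j + 2]) =
    - (mvar R[i] * lvar R[i]) * P (fill L [eta k with j |-> k j + 1])
    - lvar R[i] ^+ 2 * P (fill L k).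
Proof.
have [u [v [i [st [run_u run_v st_i eq_fill]]]]] := fill_disc p L k j.
have eq_upd n : slices (fill L [eta k with j |-> n]) = u ++ braid_power i n ++ v.
  rewrite eq_fill /= ?eqxx // => j' /negbTE nj' /=; by rewrite nj'.
(* A crossing of parallel strands leaves the level [st] unchanged, so the extended word still closes
   up. *)
have closed s : run [::] (u ++ (i, Cross s) :: braid_power i (k j + 1) ++ v)
    == Some [::].
  rewrite run_cat run_u /= -/(step st (i, Cross s)) run_parallel_cross //=.
  by rewrite run_cat run_braid_power //= run_v.
pose D s := LinkDiagram (closed s).
have PDm : P (D true) = P (fill L [eta k with j |-> k j + 2]).
  apply: (homfly_isotopy hP); apply: (isotopic_braid_cross _ _ u v i true (k j + 1)) => //.
  by rewrite eq_upd -addrA.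
have PDp : P (D false) = P (fill L k).
  apply: (homfly_isotopy hP); apply: (isotopic_braid_cross _ _ u v i false (k j + 1)) => //.
  by rewrite eq_fill // addrK.
have : skein_triple (D false) (D true) (fill L [eta k with j |-> k j + 1]).
  (* For two downward strands [cross_of_sign true] reduces to [Cross false], and the smoothing is
     the empty word, leaving exactly the filling with exponent [k j + 1]. *)
  exists u, (braid_power i (k j + 1) ++ v), i, st, (drop 2 (drop i st)), true, true.
  split; first exact: run_u.
  split; first by rewrite -[LHS](cat_take_drop 2) st_i.
  by do 2!split=> //; exact: eq_upd.
move/(homfly_skein hP); rewrite PDm PDp.
exact: skein_solve (lvar_unit _).
Qed.
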